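(* Let $p$ be an odd prime and let $Q$ be a finite commutative automorphic $p$-loop. Then $Q$ is centrally nilpotent.
   Context: A loop $(Q,\cdot)$ is a set with a binary operation such that for each $x\in Q$ the left translation $L_x:y\mapsto xy$ and the right translation $R_x:y\mapsto yx$ are bijections of $Q$, and there is $1\in Q$ with $1\cdot x=x\cdot 1=x$ for all $x$. The multiplication group is the permutation group generated by all $L_x,R_x$; the inner mapping group $\mathrm{Inn}\,Q$ is the stabilizer of $1$ in it. $Q$ is automorphic if every element of $\mathrm{Inn}\,Q$ is an automorphism of $Q$. Automorphic loops are power-associative ($x^mx^n=x^{m+n}$ for all integers $m,n$), so orders of elements are well defined. A finite commutative automorphic loop is a $p$-loop if its order is a power of $p$ (it is known that for finite commutative automorphic loops this is equivalent to every element having order a power of $p$). The center is $Z(Q)=\{a\in Q: ax=xa,\ ax\cdot y=a\cdot xy,\ xa\cdot y=x\cdot ay,\ xy\cdot a=x\cdot ya\ \text{for all }x,y\in Q\}$, a normal subloop (a subloop invariant under $\mathrm{Inn}\,Q$). Put $Z_0(Q)=\{1\}$ and let $Z_{i+1}(Q)$ be the preimage of $Z(Q/Z_i(Q))$ under the canonical projection $Q\to Q/Z_i(Q)$. $Q$ is centrally nilpotent if $Z_n(Q)=Q$ for some $n\ge 0$. *)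

(* Defs.v *)
From HB Require Import structures.
From mathcomp Require Import all_boot all_fingroup.

Set Implicit Arguments.
Unset Strict Implicit.
Unset Printing Implicit Defensive.

Import GroupScope.

HB.mixin Record Finite_isLoop Q of Finite Q := {
  loop_mul : Q -> Q -> Q;
  loop_one : Q;
  mul1l : left_id loop_one loop_mul;
  mull1 : right_id loop_one loop_mul;
  lmul_bij : forall x, bijective (fun y => loop_mul x y);
  rmul_bij : forall x, bijective (fun y => loop_mul y x)
}.

#[short(type="finLoopType")]
HB.structure Definition FinLoop := {Q of Finite_isLoop Q & Finite Q}.

Declare Scope loop_scope.
Delimit Scope loop_scope with loop.
Bind Scope loop_scope with FinLoop.sort.
Notation "x * y" := (loop_mul x y) : loop_scope.
Notation "1" := (@loop_one _) : loop_scope.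

(* In this file * and 1 denote the loop operations; those of a permutation
   group are marked with the group_scope delimiter. *)
Local Open Scope loop_scope.

Section Translations.
Variable Q : finLoopType.
Implicit Types x y z : Q.

Definition ltrans x : {perm Q} := perm (bij_inj (lmul_bij x)).
Definition rtrans x : {perm Q} := perm (bij_inj (rmul_bij x)).

(* ldiv x y is the solution z of x * z = y, and rdiv y x that of z * x = y. *)
Definition ldiv x y : Q := (ltrans x)^-1%g y.
Definition rdiv y x : Q := (rtrans x)^-1%g y.

Definition Mlt : {group {perm Q}} :=
  <<[set ltrans x | x in Q] :|: [set rtrans x | x in Q]>>%G.

Definition Inn : {group {perm Q}} := 'C_Mlt[loop_one | 'P]%G.

(* Elements of Inn are permutations, so multiplicativity is all that is needed
   for them to be automorphisms. *)
Definition automorphic : Prop :=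
  {in Inn, forall f : {perm Q}, {morph f : x y / x * y}}.

Definition loop_center : {set Q} :=
  [set a | [forall x : Q, a * x == x * a] &
     [forall x : Q, forall y : Q,
       [&& a * x * y == a * (x * y), x * a * y == x * (a * y)
         & x * y * a == x * (y * a)]]].

Definition subloop (N : {set Q}) : Prop :=
  [/\ 1 \in N, {in N &, forall x y, x * y \in N},
      {in N &, forall x y, ldiv x y \in N}
    & {in N &, forall x y, rdiv x y \in N}].

Definition loop_normal (N : {set Q}) : Prop :=
  subloop N /\ [acts Inn, on N | 'P].

Record normalSubloop := NormalSubloop {
  nsl_set :> {set Q};
  nsl_normal : loop_normal nsl_set
}.

Definition loop_lcoset (N : {set Q}) x : {set Q} := [set x * n | n in N].

Lemma ltransE x y : ltrans x y = x * y. Proof. by rewrite permE. Qed.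
Lemma rtransE x y : rtrans x y = y * x. Proof. by rewrite permE. Qed.

Lemma mulIl x : injective (fun y : Q => x * y).
Proof. exact: bij_inj (lmul_bij x). Qed.
Lemma mulIr x : injective (fun y : Q => y * x).
Proof. exact: bij_inj (rmul_bij x). Qed.

Lemma ldivK x y : x * ldiv x y = y.
Proof. by rewrite -ltransE permKV. Qed.
Lemma rdivK y x : rdiv y x * x = y.
Proof. by rewrite -rtransE permKV. Qed.

Lemma ltrans_Mlt x : ltrans x \in Mlt.
Proof. by apply/mem_gen/setUP; left; apply: imset_f. Qed.
Lemma rtrans_Mlt x : rtrans x \in Mlt.
Proof. by apply/mem_gen/setUP; right; apply: imset_f. Qed.

Lemma InnP (f : {perm Q}) : reflect (f \in Mlt /\ f 1 = 1) (f \in Inn).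
Proof.
rewrite inE; apply: (iffP andP) => -[fM f1]; split=> //.
  by move/astab1P: f1.
exact/astab1P.
Qed.

Lemma nsl1 (N : normalSubloop) : 1 \in (N : {set Q}).
Proof. by case: N => N [[]]. Qed.

Lemma Inn_nsl (N : normalSubloop) (f : {perm Q}) n :
  f \in Inn -> (f n \in (N : {set Q})) = (n \in (N : {set Q})).
Proof. by move=> fI; have [_ /acts_act->] := nsl_normal N. Qed.

(* Any element of Mlt maps x N onto the coset of the image of x. *)
Lemma Mlt_lcoset (N : normalSubloop) (f : {perm Q}) x n :
  f \in Mlt -> n \in (N : {set Q}) -> f (x * n) \in loop_lcoset N (f x).
Proof.
move=> fM nN; pose g := (ltrans x * f * (ltrans (f x))^-1)%g.
have gI : g \in Inn.
  apply/InnP; split; first by rewrite !(groupM, groupV) ?ltrans_Mlt.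
  rewrite !permM ltransE mull1.
  by apply: (mulIl (x := f x)) => /=; rewrite -ltransE permKV mull1.
apply/imsetP; exists (g n); first by rewrite Inn_nsl.
by rewrite !permM -(ltransE (f x)) permKV ltransE.
Qed.

Lemma lcoset_self (N : normalSubloop) x : x \in loop_lcoset N x.
Proof. by apply/imsetP; exists 1; rewrite ?nsl1 ?mull1. Qed.

Lemma lcoset_eq (N : normalSubloop) x y :
  y \in loop_lcoset N x -> loop_lcoset N y = loop_lcoset N x.
Proof.
have [[_ Nm _ _] _] := nsl_normal N.
move=> yx; have cardE z : #|loop_lcoset N z| = #|(N : {set Q})|.
  by apply: card_imset; exact: mulIl.
apply/eqP; rewrite eqEcard !cardE leqnn andbT.
case/imsetP: yx => n nN ->; apply/subsetP=> _ /imsetP[m mN ->].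
pose g := (ltrans n * ltrans x * (ltrans (x * n)%loop)^-1)%g.
have gI : g \in Inn.
  apply/InnP; split; first by rewrite !(groupM, groupV) ?ltrans_Mlt.
  rewrite !permM !ltransE mull1.
  by apply: (mulIl (x := x * n)) => /=; rewrite -ltransE permKV mull1.
apply/imsetP; exists (n * g^-1%g m); last first.
  have gE k : x * n * g k = x * (n * k).
    by rewrite /g !permM -ltransE permKV !ltransE.
  by rewrite -gE permKV.
by apply: Nm => //; rewrite Inn_nsl ?groupV.
Qed.

Lemma lcosetM (N : normalSubloop) x y x' y' :
  x' \in loop_lcoset N x -> y' \in loop_lcoset N y ->
  loop_lcoset N (x' * y') = loop_lcoset N (x * y).
Proof.
case/imsetP=> n nN ->{x'} /imsetP[m mN ->].
transitivity (loop_lcoset N (x * n * y)); apply: lcoset_eq.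
  by rewrite -!(ltransE (x * n)); apply: Mlt_lcoset (ltrans_Mlt _) mN.
by rewrite -!(rtransE y); apply: Mlt_lcoset (rtrans_Mlt _) nN.
Qed.

End Translations.

Section Quotient.
Variables (Q : finLoopType) (N : normalSubloop Q).
Implicit Types (x y z : Q).

Definition loop_cosets : {set {set Q}} := [set loop_lcoset N x | x in Q].

Lemma mem_loop_cosets x : loop_lcoset N x \in loop_cosets.
Proof. by apply/imsetP; exists x. Qed.

Record loop_quotient := LoopCoset {
  lcoset_val : {set Q};
  _ : lcoset_val \in loop_cosets
}.

HB.instance Definition _ := [isSub for lcoset_val].
HB.instance Definition _ := [Finite of loop_quotient by <:].

Definition loop_proj x : loop_quotient := LoopCoset (mem_loop_cosets x).

Lemma quo_ex (A : loop_quotient) : exists x, loop_proj x == A.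
Proof.
by case/imsetP: (valP A) => x _ Ax; exists x; apply/eqP/val_inj; rewrite Ax.
Qed.

Definition quo_repr A : Q := xchoose (quo_ex A).

Definition quo_mul A B : loop_quotient := loop_proj (quo_repr A * quo_repr B).

Lemma quo_reprK A : loop_proj (quo_repr A) = A.
Proof. exact/eqP/(xchooseP (quo_ex A)). Qed.

Lemma loop_proj_eq x y : (loop_proj x = loop_proj y) <-> x \in loop_lcoset N y.
Proof.
split=> [/(congr1 val)/= <-|/lcoset_eq e]; first exact: lcoset_self.
exact: val_inj.
Qed.

Lemma quo_mulE x y : quo_mul (loop_proj x) (loop_proj y) = loop_proj (x * y).
Proof.
apply: val_inj; apply: lcosetM; apply/loop_proj_eq; exact: quo_reprK.
Qed.

Lemma quo_mul1l : left_id (loop_proj 1) quo_mul.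
Proof. by move=> A; rewrite -[A]quo_reprK quo_mulE mul1l. Qed.
Lemma quo_mulr1 : right_id (loop_proj 1) quo_mul.
Proof. by move=> A; rewrite -[A]quo_reprK quo_mulE mull1. Qed.

Lemma quo_lmul_bij A : bijective (fun B => quo_mul A B).
Proof.
have h C : quo_mul A (loop_proj (ldiv (quo_repr A) (quo_repr C))) = C.
  by rewrite -[X in quo_mul X _]quo_reprK quo_mulE ldivK quo_reprK.
have [f fK Kf] := injF_bij (can_inj h).
exists (fun C => loop_proj (ldiv (quo_repr A) (quo_repr C))) => // B.
by rewrite -{1}[B]Kf h Kf.
Qed.

Lemma quo_rmul_bij A : bijective (fun B => quo_mul B A).
Proof.
have h C : quo_mul (loop_proj (rdiv (quo_repr C) (quo_repr A))) A = C.
  by rewrite -[X in quo_mul _ X]quo_reprK quo_mulE rdivK quo_reprK.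
have [f fK Kf] := injF_bij (can_inj (h : cancel _ (quo_mul^~ A))).
exists (fun C => loop_proj (rdiv (quo_repr C) (quo_repr A))) => // B.
by rewrite -{1}[B]Kf h Kf.
Qed.

HB.instance Definition _ := Finite_isLoop.Build loop_quotient
  quo_mul1l quo_mulr1 quo_lmul_bij quo_rmul_bij.

Lemma loop_projM x y : loop_proj (x * y) = loop_proj x * loop_proj y.
Proof. by rewrite -quo_mulE. Qed.

Lemma loop_proj1 : loop_proj 1 = 1. Proof. by []. Qed.

Lemma Mlt_proj (f : {perm Q}) : f \in Mlt Q ->
  exists2 g : {perm loop_quotient},
    g \in Mlt loop_quotient & forall x, loop_proj (f x) = g (loop_proj x).
Proof.
pose P f := [exists g : {perm loop_quotient}, (g \in Mlt loop_quotient)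
  && [forall x, loop_proj (f x) == g (loop_proj x)]].
have PP h : reflect (exists2 g : {perm loop_quotient},
    g \in Mlt loop_quotient & forall x, loop_proj (h x) = g (loop_proj x)) (P h).
  apply: (iffP existsP) => [[g /andP[gM /forallP gE]]|[g gM gE]].
    by exists g => // x; apply/eqP.
  by exists g; rewrite gM; apply/forallP=> x; apply/eqP.
have gP : group_set [set f : {perm Q} | P f].
  apply/group_setP; split=> [|h k]; rewrite !inE.
    by apply/PP; exists 1%g; rewrite ?group1 // => x; rewrite !perm1.
  move=> /PP[g gM gE] /PP[g' gM' gE']; apply/PP; exists (g * g')%g.
    exact: groupM.
  by move=> x; rewrite !permM gE' gE.
move=> fM; apply/PP; suff: Mlt Q \subset Group gP.
  by move/subsetP/(_ _ fM); rewrite inE.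
rewrite gen_subG subUset; apply/andP.
split; apply/subsetP=> _ /imsetP[x _ ->]; rewrite inE; apply/PP.
  exists (ltrans (loop_proj x)) => [|y]; first exact: ltrans_Mlt.
  by rewrite !ltransE loop_projM.
exists (rtrans (loop_proj x)) => [|y]; first exact: rtrans_Mlt.
by rewrite !rtransE loop_projM.
Qed.

Lemma preim_normal (M : normalSubloop loop_quotient) :
  loop_normal [set x | loop_proj x \in (M : {set loop_quotient})].
Proof.
have [[M1 Mm Ml Mr] _] := nsl_normal M.
split; first split.
- by rewrite inE.
- by move=> x y; rewrite !inE loop_projM; apply: Mm.
- move=> x y; rewrite !inE => xM yM.
  have -> : loop_proj (ldiv x y) = ldiv (loop_proj x) (loop_proj y).
    by apply: (mulIl (x := loop_proj x)); rewrite -loop_projM !ldivK.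
  exact: Ml.
- move=> x y; rewrite !inE => xM yM.
  have -> : loop_proj (rdiv x y) = rdiv (loop_proj x) (loop_proj y).
    by apply: (mulIr (x := loop_proj y)); rewrite -loop_projM !rdivK.
  exact: Mr.
apply/actsP=> f /InnP[fM f1] x; rewrite !inE.
have [g gM gE] := Mlt_proj fM.
have gI : g \in Inn loop_quotient.
  by apply/InnP; split; rewrite // -loop_proj1 -gE f1.
by rewrite /= apermE gE Inn_nsl.
Qed.

End Quotient.

Section CentralNormal.
Variable Q : finLoopType.
Implicit Types x y z : Q.

Lemma triv_normal : loop_normal [set 1 : Q].
Proof.
split; first split; first by rewrite inE.
- by move=> x y /set1P-> /set1P->; rewrite mull1 inE.
- move=> x y /set1P-> /set1P->; rewrite inE; apply/eqP.
  by apply: (mulIl (x := 1)); rewrite ldivK mull1.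
- move=> x y /set1P-> /set1P->; rewrite inE; apply/eqP.
  by apply: (mulIr (x := 1)); rewrite rdivK mull1.
apply/actsP=> f /InnP[_ f1] x; rewrite !inE /= apermE.
by rewrite -{1}f1 (inj_eq perm_inj).
Qed.

Lemma loop_centerP a :
  reflect [/\ forall x : Q, a * x = x * a,
              forall x y : Q, a * x * y = a * (x * y),
              forall x y : Q, x * a * y = x * (a * y)
            & forall x y : Q, x * y * a = x * (y * a)]
          (a \in loop_center Q).
Proof.
rewrite inE; apply: (iffP andP) => [[/forallP c /forallP h]|[c h1 h2 h3]].
  have {}h x y := and3P (forallP (h x) y).
  split=> [x|x y|x y|x y]; first exact/eqP.
  - by have [/eqP] := h x y.
  - by have [_ /eqP] := h x y.
  - by have [_ _ /eqP] := h x y.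
split; first by apply/forallP=> x; rewrite c.
by apply/forallP=> x; apply/forallP=> y; rewrite h1 h2 h3 !eqxx.
Qed.

Lemma center_Mlt a (f : {perm Q}) x :
  a \in loop_center Q -> f \in Mlt Q -> f (a * x) = a * f x.
Proof.
case/loop_centerP=> c h1 h2 h3 fM.
suff: Mlt Q \subset 'C[ltrans a].
  move/subsetP/(_ _ fM)/cent1P/permP/(_ x).
  by rewrite !permM !ltransE => ->.
rewrite gen_subG subUset; apply/andP.
split; apply/subsetP=> _ /imsetP[z _ ->]; apply/cent1P/permP=> y;
  rewrite !permM !(ltransE, rtransE) ?h1 //.
by rewrite -h2 -c h1.
Qed.

Lemma center_fixed a (f : {perm Q}) :
  a \in loop_center Q -> f \in Inn Q -> f a = a.
Proof.
move=> aZ /InnP[fM f1].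
by rewrite -[in LHS](mull1 a) center_Mlt // f1 mull1.
Qed.

Lemma center_swap a x y :
  a \in loop_center Q -> x * (a * y) = a * (x * y).
Proof. by move=> /loop_centerP[ca a1 a2 _]; rewrite -a2 -ca a1. Qed.

Lemma center_mul a b :
  a \in loop_center Q -> b \in loop_center Q -> a * b \in loop_center Q.
Proof.
move=> aZ bZ; have [ca a1 a2 _] := loop_centerP _ aZ.
have [cb b1 _ _] := loop_centerP _ bZ.
have c x : a * b * x = x * (a * b) by rewrite a1 cb -a1 ca a2.
have l x y : a * b * x * y = a * b * (x * y) by rewrite !a1 b1.
have m x y : x * (a * b * y) = a * b * (x * y).
  by rewrite !a1 (center_swap x _ aZ) (center_swap x _ bZ).
by apply/loop_centerP; split=> // x y; rewrite -!c ?l ?m.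
Qed.

Lemma center_ldiv a b :
  a \in loop_center Q -> b \in loop_center Q -> ldiv a b \in loop_center Q.
Proof.
move=> aZ bZ; set d := ldiv a b; have adE : a * d = b by rewrite /d ldivK.
have [ca a1 _ _] := loop_centerP _ aZ.
have [cb b1 b2 b3] := loop_centerP _ bZ.
have adl x : a * (d * x) = b * x by rewrite -a1 adE.
have adr x : a * (x * d) = x * b by rewrite -center_swap // adE.
apply/loop_centerP; split=> [x|x y|x y|x y]; apply: (mulIl (x := a)) => /=.
- by rewrite adl adr.
- by rewrite -a1 !adl b1.
- by rewrite -a1 adr -center_swap // adl b2.
- by rewrite adr -center_swap // adr b3.
Qed.

Lemma center_normal : loop_normal (loop_center Q).
Proof.
split; first split.
- apply/loop_centerP; split=> *; by rewrite ?mul1l ?mull1.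
- by move=> a b; apply: center_mul.
- by move=> a b; apply: center_ldiv.
- move=> a b aZ bZ; suff -> : rdiv a b = ldiv b a by exact: center_ldiv.
  apply: (mulIr (x := b)) => /=.
  by have /loop_centerP[cb _ _ _] := bZ; rewrite rdivK -cb ldivK.
apply/actsP=> f fI x; rewrite /= apermE; apply/idP/idP=> xZ.
  by rewrite -(permK f x) (center_fixed xZ) ?groupV.
by rewrite (center_fixed xZ).
Qed.

End CentralNormal.

Definition center_nsl (Q : finLoopType) : normalSubloop Q :=
  NormalSubloop (center_normal Q).

Definition preim_nsl (Q : finLoopType) (N : normalSubloop Q)
    (M : normalSubloop (loop_quotient N)) : normalSubloop Q :=
  NormalSubloop (preim_normal M).

Fixpoint upper_central (Q : finLoopType) (i : nat) : normalSubloop Q :=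
  if i is j.+1 then
    preim_nsl (center_nsl (loop_quotient (upper_central Q j)))
  else NormalSubloop (triv_normal Q).

Definition centrally_nilpotent (Q : finLoopType) : Prop :=
  exists n : nat, upper_central Q n = [set: Q] :> {set Q}.

Definition loop_commutative (Q : finLoopType) : Prop :=
  commutative (@loop_mul Q).

Definition p_loop (p : nat) (Q : finLoopType) : Prop :=
  exists k : nat, #|Q| = (p ^ k)%N.

(* Main.v *)
(* Write [L_x] for left translations, [G = Mlt Q], [H = Inn Q], and let [J] be
   inversion [x -> x^-1]. Inversion is an automorphism, so [J] is an involution
   normalizing [G] and centralizing [H]; as [|Q|] is odd, [1] is its only fixed
   point. Fixed-point arguments in the [p^k] points of [Q] show that every
   commutator [[J, g]] with [g] in [G] is a [p]-element. Hence [J] normalizes a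
   Sylow [p]-subgroup [X] of [G]; since [G = H X], the group [A = [J, G]] lies in
   [X], so it is a [p]-group, and it is transitive because squaring is onto.
   The elementary abelian group [V = Ohm_1(Z(A))] acts freely on [Q] and is
   inverted by [J]. Writing [r_x] for the action of [L_x] on [V] by conjugation,
   commutativity of [Q] gives [r_(v x) = r_x] for [v] in [V], and automorphicity
   gives d'Alembert's equation [r_(b y) + r_(b y^-1) = 2 r_y r_b]. Therefore the
   [r_x] commute and, in characteristic [p], have [p]-power order; so [G] acts on
   [V] as a [p]-group and centralizes some [v <> 1] in [V], and [v(1)] is a
   nontrivial element of the center of [Q]. *)

Require Import Defs.
From mathcomp Require Import all_boot all_fingroup.
From mathcomp Require Import all_algebra all_solvable mxabelem.

Set Implicit Arguments.
Unset Strict Implicit.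
Unset Printing Implicit Defensive.

Import GroupScope.

(** * Binomial coefficients and d'Alembert's equation in characteristic [p] *)

Lemma dvdn_bin_expn p r k : prime p -> 0 < k < p ^ r -> p %| 'C(p ^ r, k).
Proof.
(* If [p] did not divide the coefficient, [p ^ r * 'C((p ^ r).-1, k) = k.+1 * 'C(p ^ r, k.+1)] would
   force [p ^ r] to divide [k.+1]. *)
case: k => // k p_pr /= ltkq; apply: contraLR ltkq => npC; rewrite -leqNgt.
apply: dvdn_leq => //; rewrite -(@Gauss_dvdl _ _ 'C(p ^ r, k.+1)).
  by rewrite -mul_bin_diag dvdn_mulr.
by rewrite coprimeXl // prime_coprime.
Qed.

Lemma fermat_expn a p r : prime p -> a ^ (p ^ r) = a %[mod p].
Proof.
move=> p_pr; elim: r => [|r IHr]; first by rewrite expn0 expn1.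
by rewrite expnSr expnM fermat_little.
Qed.

Section DAlembert.
Import GRing.Theory.
Local Open Scope ring_scope.
Variables (U : zmodType) (T : U -> U) (g : nat -> U).
Hypothesis T_add : {morph T : x y / x + y}.
Hypothesis g_step : forall n, g n + g n.+2 = T (g n.+1) *+ 2.

Let iter_add n : {morph iter n T : x y / x + y}.
Proof. by elim: n => // n IHn x y /=; rewrite IHn T_add. Qed.

(** With [S] the shift of indices, [g_step] reads [(1 + S^2) g = 2 T S g]. As [T] and [S] commute,
    both operators can be raised to the power [N]. *)
Lemma dAlembert_binomial N n :
  iter N T (g (n + N)) *+ 2 ^ N = \sum_(k < N.+1) g (n + k.*2) *+ 'C(N, k).
Proof.
elim: N n => [|N IHN] n.
  by rewrite big_ord_recl big_ord0 /= addr0 addn0 bin0 expn0.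
have iter_mul m x k : iter k T (x *+ m.+1) = iter k T x *+ m.+1.
  by elim: m => // m IHm; rewrite mulrSr iter_add IHm -mulrSr.
rewrite iterSr expnS mulrnA -iter_mul addnS -g_step iter_add mulrnDl IHN.
rewrite -addn2 addnAC IHN [RHS]big_ord_recl bin0 /=.
under [in RHS]eq_bigr => k _ do rewrite binS mulrnDr.
rewrite big_split addrA; congr (_ + _); last first.
  by apply: eq_bigr => k _; rewrite /bump /= doubleS !addnS addSn addn0.
rewrite big_ord_recl bin0; congr (_ + _).
by rewrite [RHS]big_ord_recr /= bin_small // mulr0n addr0.
Qed.

(** For [N = p ^ r] only the two end terms of the binomial sum survive, both equal to [g 0] by
    periodicity, and [2 ^ N] acts as [2] by Fermat. *)
Lemma dAlembert_pow p r : prime p -> (forall x : U, x *+ p = 0) ->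
    (forall n, g (n + p ^ r) = g n) ->
  iter (p ^ r) T (g 0) *+ 2 = g 0 *+ 2.
Proof.
move=> p_pr charU g_per.
have mulrn_mod x m n : (m = n %[mod p])%N -> x *+ m = x *+ n :> U.
  move=> mn; rewrite (divn_eq m p) (divn_eq n p) mn !mulrnDr.
  by rewrite !(mulnC _ p) !mulrnA charU !mul0rn.
rewrite -(mulrn_mod _ _ _ (fermat_expn 2 r p_pr)) -{1}(g_per 0) dAlembert_binomial.
have [q def_q] : exists q, (p ^ r = q.+1)%N.
  by exists (p ^ r).-1%N; rewrite prednK // expn_gt0 prime_gt0.
rewrite big_ord_recl def_q big_ord_recr /= big1 => [|k _]; last first.
  have /dvdnP[m ->] : (p %| 'C(q.+1, bump 0 k))%N.
    by rewrite -def_q dvdn_bin_expn // def_q /bump /= ltnS.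
  by rewrite mulnC mulrnA charU mul0rn.
rewrite add0r bin0 binn !add0n /bump /= add1n -def_q !mulr1n -[(p ^ r).*2]addnn.
by rewrite g_per -[(p ^ r)%N]add0n g_per mulr2n.
Qed.

End DAlembert.

(** * Involutions, Sylow subgroups and fixed points *)

Section GroupLemmas.
Variable gT : finGroupType.

Lemma involution_inv (J : gT) : J * J = 1 -> J^-1 = J.
Proof. by move=> JJ; apply/eqP; rewrite eq_invg_mul JJ. Qed.

Lemma involution_comm_conj (J g : gT) : J * J = 1 -> [~ J, g] ^ J = [~ J, g]^-1.
Proof.
move=> JJ; have J1 := involution_inv JJ.
by rewrite /commg /conjg !invMg !J1 invgK !mulgA JJ mul1g.
Qed.

(* A maximal [J]-invariant [p]-subgroup [X] is a Sylow subgroup of ['N_G(X)], by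
   induction, hence of [G]. If [X] is normal, then [X] and any commutator
   [[J, g]], which [J] inverts, generate a [J]-invariant [p]-subgroup. *)
Lemma involution_normalizes_Sylow (p : nat) (G : {group gT}) (J : gT) :
    J * J = 1 -> J \in 'N(G) -> {in G, forall g, p.-elt [~ J, g]} ->
  exists2 P : {group gT}, p.-Sylow(G) P & J \in 'N(P).
Proof.
move=> JJ; move: {2}_.+1 (ltnSn #|G|) => n.
elim: n G => // n IHn G; rewrite ltnS => leGn nGJ pJ.
have comG g : g \in G -> [~ J, g] \in G.
  by move=> Gg; rewrite commgEr groupMr // memJ_norm // groupV.
pose inv (X : {group gT}) := [&& p.-group X, X \subset G & J \in 'N(X)].
have inv1 : inv 1%G by rewrite /inv pgroup1 sub1G norm1 inE.
have [X /maxgroupP[/and3P[pX sXG nXJ] maxX] _] :=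
  maxgroup_exists (gP := inv) inv1.
have nNJ : J \in 'N('N_G(X)).
  have : <[J]> \subset 'N('N_G(X)).
    by rewrite normsI ?norms_norm ?cycle_subG.
  by rewrite cycle_subG.
case: (eqVproper (subsetIl G 'N(X))) => [eNG | ltNG]; last first.
  have [||P sylP nPJ] := IHn 'N_G(X)%G _ nNJ.
  - exact: leq_trans (proper_card ltNG) leGn.
  - by move=> g /setIP[Gg _]; apply: pJ.
  have [sPN pP _] := and3P sylP.
  have nsX : X <| 'N_G(X) by rewrite /normal subsetI sXG normG subsetIr.
  have sXP : X \subset P.
    by apply: subset_trans (pcore_max pX nsX) (pcore_sub_Hall sylP).
  have PX : P :=: X.
    by apply: maxX => //; rewrite /inv pP nPJ (subset_trans sPN) ?subsetIl.
  exists X => //; have [S sylS sXS] := Sylow_superset sXG pX.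
  suff -> : X :=: S by [].
  have [sSG pS _] := and3P sylS.
  apply/esym; apply: (nilpotent_sub_norm (pgroup_nil pS) sXS).
  rewrite -PX (_ : 'N_S(P) = P) // PX.
  rewrite PX in sylP; apply: (sub_pHall sylP).
  - exact: pgroupS (subsetIl _ _) pS.
  - by rewrite subsetI sXS normG.
  - exact: setSI.
have nXG : G \subset 'N(X) by rewrite -eNG subsetIr.
have [allX | ] := boolP [forall g in G, [~ J, g] \in X].
  have [S sylS sXS] := Sylow_superset sXG pX.
  exists S => //; have [sSG _ _] := and3P sylS.
  rewrite inE; apply/subsetP=> _ /imsetP[s Ss ->].
  rewrite conjg_mulR groupM // -invg_comm groupV.
  by apply: (subsetP sXS); apply: (forall_inP allX); apply: (subsetP sSG).
rewrite negb_forall => /existsP[g]; rewrite negb_imply => /andP[Gg nXr].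
set r := [~ J, g] in nXr.
have Gr : r \in G by exact: comG.
have nXr' : <[r]> \subset 'N(X) by rewrite cycle_subG (subsetP nXG).
case/negP: nXr.
have XrX : X <*> <[r]> = X.
  apply: (maxX (X <*> <[r]>)%G); last exact: joing_subl.
  rewrite /inv /= norm_joinEr // pgroupM pX -norm_joinEr // join_subG sXG.
  rewrite cycle_subG Gr (pJ g Gg : p.-group <[r]>) /=.
  have : <[J]> \subset 'N(X <*> <[r]>).
    rewrite normsY // cycle_subG // inE -cycleJ involution_comm_conj //.
    by rewrite cycleV.
  by rewrite cycle_subG.
by rewrite -XrX mem_gen // inE cycle_id orbT.
Qed.

Lemma pgroup_fixpoint (T : finType) (q : nat) (P : {group {perm T}}) :
    q.-group P -> ~~ (q %| #|T|) ->
  exists y, {in P, forall c : {perm T}, c y = y}.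
Proof.
move=> qP nq; have actsP : [acts P, on [set: T] | 'P].
  by apply/actsP=> a _ x; rewrite !inE.
have := pgroup_fix_mod qP actsP.
case: (set_0Vmem 'Fix_([set: T] | 'P)(P)) => [-> | [y]].
  by rewrite cards0 cardsT mod0n => /eqP; rewrite -/(dvdn _ _) (negPf nq).
by case/setIP=> _ /afixP fy _; exists y => c /fy.
Qed.

End GroupLemmas.

(** * Inversion in a commutative automorphic loop *)

Definition linv (Q : finLoopType) (x : Q) : Q := ldiv x (loop_one : Q).

Section CommutativeAutomorphic.
Variable Q : finLoopType.
Hypothesis mulC : loop_commutative Q.
Hypothesis autoQ : automorphic Q.
Local Open Scope loop_scope.
Implicit Types (x y z : Q) (f g h : {perm Q}).

Lemma Inn_morph f x y : f \in Inn Q -> f (x * y) = f x * f y.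
Proof. by move=> /autoQ->. Qed.

Lemma Inn1 f : f \in Inn Q -> f 1 = 1.
Proof. by case/InnP. Qed.

Lemma ltrans1 : ltrans 1 = 1%g :> {perm Q}.
Proof. by apply/permP=> z; rewrite ltransE mul1l perm1. Qed.

Lemma mul_linv x : x * linv x = 1.
Proof. exact: ldivK. Qed.

Lemma linv_uniq x y : x * y = 1 -> y = linv x.
Proof. by move=> xy; apply: (mulIl (x := x)); rewrite /= xy mul_linv. Qed.

Lemma linvK : involutive (@linv Q).
Proof. by move=> x; rewrite -(@linv_uniq (linv x) x) // mulC mul_linv. Qed.

Lemma linv1 : linv 1 = 1 :> Q.
Proof. by rewrite -(@linv_uniq 1 1) // mul1l. Qed.

Lemma Inn_linv f x : f \in Inn Q -> f (linv x) = linv (f x).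
Proof. by move=> fI; apply: linv_uniq; rewrite -Inn_morph // mul_linv Inn1. Qed.

Lemma Inn_ltransJ f x : f \in Inn Q -> (ltrans x ^ f = ltrans (f x))%g.
Proof.
move=> fI; apply/permP=> z; rewrite -[z](permKV f) permJ !ltransE.
by rewrite Inn_morph.
Qed.

(* With [u = (xy)^-1] and [t = y \ x^-1], the inner map [f = L_u L_x L_y] sends
   [t] to [u], so that [f = L_x L_y L_t], and [L_y L_t] agrees up to [L_(x^-1)]
   with an inner map fixing [y]; now evaluate [f] at [y^-1]. *)
Lemma linvM x y : linv (x * y) = linv x * linv y.
Proof.
set u := linv (x * y); pose t := ldiv y (linv x).
have yt : y * t = linv x by exact: ldivK.
pose f := (ltrans y * ltrans x * ltrans u)%g.
have fE z : f z = u * (x * (y * z)) by rewrite !permM !ltransE.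
have fI : f \in Inn Q.
  apply/InnP; split; first by rewrite !groupM ?ltrans_Mlt.
  by rewrite fE mull1 mulC mul_linv.
have ft z : f z = x * (y * (t * z)).
  apply: (mulIl (x := u)) => /=; rewrite -fE Inn_morph //.
  by rewrite [f t]fE yt mul_linv mull1.
pose k := (ltrans t * ltrans y * (ltrans (linv x))^-1)%g.
have kE z : linv x * k z = y * (t * z).
  by rewrite -ltransE permM permKV permM !ltransE.
have kI : k \in Inn Q.
  apply/InnP; split; first by rewrite !(groupM, groupV) ?ltrans_Mlt.
  by apply: (mulIl (x := linv x)); rewrite /= kE !mull1.
have ky : k (linv y) = linv y.
  rewrite Inn_linv //; congr linv; apply: (mulIl (x := linv x)).
  by rewrite /= kE [t * y]mulC yt mulC.
have := ft (linv y); rewrite fE mul_linv mull1 -kE ky mulC.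
by move/(mulIl (x := x)).
Qed.

Definition linv_perm : {perm Q} := perm (inv_inj linvK).
Local Notation J := linv_perm.

Lemma linv_permE x : J x = linv x. Proof. by rewrite permE. Qed.

Lemma linv_perm_invol : (J * J = 1)%g.
Proof. by apply/permP=> x; rewrite permM !linv_permE linvK perm1. Qed.

Lemma linv_permV : (J^-1 = J)%g.
Proof. exact: involution_inv linv_perm_invol. Qed.

Lemma ltrans_linv x : (ltrans x ^ J = ltrans (linv x))%g.
Proof.
apply/permP=> z; rewrite -[z](permKV J) permJ permKV !linv_permE !ltransE.
by rewrite linvM linv_permV linv_permE linvK.
Qed.

Lemma MltE : Mlt Q = <<[set ltrans x | x in Q]>>%g :> {set {perm Q}}.
Proof.
rewrite /Mlt /=; congr <<_>>; apply/setUidPl/subsetP=> _ /imsetP[x _ ->].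
suff -> : rtrans x = ltrans x by exact: imset_f.
by apply/permP=> y; rewrite ltransE rtransE mulC.
Qed.

Lemma linv_norm : J \in ('N(Mlt Q))%g.
Proof.
rewrite MltE; apply: (subsetP (norm_gen _)); rewrite inE.
apply/subsetP=> _ /imsetP[_ /imsetP[x _ ->] ->].
by rewrite ltrans_linv imset_f.
Qed.

Lemma Inn_linv_perm f : f \in Inn Q -> commute f J.
Proof.
by move=> fI; apply/permP=> x; rewrite !permM !linv_permE Inn_linv.
Qed.

Lemma Inn_linv_conj f : f \in Inn Q -> (J ^ f = J)%g.
Proof. by move/Inn_linv_perm=> fJ; rewrite /conjg -fJ mulKg. Qed.

Lemma Mlt_ltransV f y : f \in Mlt Q -> f y = y -> (f ^ (ltrans y)^-1)%g \in Inn Q.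
Proof.
move=> fM fy; apply/InnP; split.
  by rewrite groupJ ?groupV ?ltrans_Mlt.
have <- : (ltrans y)^-1%g y = 1 by rewrite -{2}[y](mull1 y) -ltransE permK.
by rewrite permJ fy.
Qed.

(** The product [e] of the two translations is an inner map fixing [y], so it commutes with
    [ltrans y] by [Inn_ltransJ]. *)
Lemma ltrans_linvC y : commute (ltrans y) (ltrans (linv y)).
Proof.
pose e := (ltrans (linv y) * ltrans y)%g.
have eI : e \in Inn Q.
  apply/InnP; split; first by rewrite groupM ?ltrans_Mlt.
  by rewrite permM !ltransE mull1 mul_linv.
have ey : e y = y by rewrite permM !ltransE [linv y * y]mulC mul_linv mull1.
have := Inn_ltransJ y eI; rewrite ey conjgM => /(canRL (conjgK _)).
by rewrite [in RHS]/conjg invgK mulgV mulg1 => /conjg_fixP/commgP.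
Qed.

(** The points [(ltrans y ^+ n) 1] serve as the powers of [y]; this goes one step back among
    them. *)
Lemma linv_mul_expn y n :
  linv y * (ltrans y ^+ n.+1)%g 1 = (ltrans y ^+ n)%g 1.
Proof.
rewrite -ltransE -permM -(commuteX _ (commute_sym (ltrans_linvC y))).
by rewrite expgS mulgA !permM !ltransE mull1 mul_linv.
Qed.

(** * Odd order: square roots and commutators with inversion *)

Section OddOrder.
Hypothesis oddQ : odd #|Q|.

(* The involution [y -> y \ c] has a fixed point because [|Q|] is odd. *)
Lemma ex_sqrt c : exists x, x * x = c.
Proof.
have invK : involutive (fun y => ldiv y c).
  move=> y; apply: (mulIl (x := ldiv y c)); rewrite /= ldivK.
  by rewrite mulC ldivK.
pose s := perm (inv_inj invK).
have s2 : 2.-group <[s]>.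
  apply: (@pnat_dvd _ 2) => //; rewrite order_dvdn expgS expg1.
  by apply/eqP/permP=> y; rewrite permM !permE invK.
have [|y fy] := pgroup_fixpoint s2; first by rewrite dvdn2 oddQ.
exists y; have := fy s (cycle_id _); rewrite permE => sy.
by rewrite -{2}sy ldivK.
Qed.

Lemma sqr_inj x y : x * x = y * y -> x = y.
Proof.
have sqP c : exists z, z * z == c by case: (ex_sqrt c) => z <-; exists z.
pose r c := xchoose (sqP c).
have rK : cancel r (fun z => z * z) by move=> c; apply/eqP/(xchooseP (sqP c)).
have [r' _ r'K] := injF_bij (can_inj rK).
by rewrite -(r'K x) -(r'K y) !rK => ->.
Qed.

Lemma linv_fix x : linv x = x -> x = 1.
Proof. by move=> xx; apply: sqr_inj; rewrite mul1l -{2}xx mul_linv. Qed.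

Lemma comm_linv_Mlt g : g \in Mlt Q -> ([~ J, g])%g \in Mlt Q.
Proof.
by move=> gM; rewrite commgEr groupMr // memJ_norm ?linv_norm // groupV.
Qed.

(* The 2-group [<J, J ^ g>] has a fixed point, which is the unique fixed point
   [1] of [J] and the unique fixed point [g 1] of [J ^ g]. *)
Lemma comm_linv_2elt g : 2.-elt ([~ J, g])%g -> g 1 = 1.
Proof.
set d := [~ J, g]%g => d2.
have dJ : <[J]> \subset 'N(<[d]>)%g.
  rewrite cycle_subG inE -cycleJ involution_comm_conj ?linv_perm_invol //.
  by rewrite cycleV.
have P2 : 2.-group (<[d]> <*> <[J]>)%g.
  rewrite norm_joinEr // pgroupM (d2 : 2.-group <[d]>)%g /=.
  apply: (@pnat_dvd _ 2) => //; rewrite order_dvdn expgS expg1.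
  by rewrite linv_perm_invol.
have [|y fy] := pgroup_fixpoint P2; first by rewrite dvdn2 oddQ.
have Jy : J y = y by apply: fy; rewrite mem_gen // inE cycle_id orbT.
have dy : d y = y by apply: fy; rewrite mem_gen // inE cycle_id.
have y1 : y = 1 by apply: linv_fix; rewrite -linv_permE.
have : (J ^ g)%g y = y by rewrite conjg_mulR permM Jy.
rewrite -{1}[y](permKV g) permJ linv_permE => /(canRL (permK g)) /linv_fix.
by move/(congr1 g); rewrite permKV y1.
Qed.

Lemma Inn_comm_linv f : f \in Inn Q -> ([~ J, f])%g = 1%g.
Proof. by move=> fI; rewrite commgEl Inn_linv_conj // mulVg. Qed.

(* With [d = [J, g]] one has [J ^ (g * d ^+ i) = J * d ^+ (2 * i + 1)], and the
   odd exponent can be chosen to kill the 2'-part of [d]. *)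
Lemma comm_linv_odd g : g \in Mlt Q -> odd #[[~ J, g]%g].
Proof.
move=> gM; set d := [~ J, g]%g; set b := (#[d]`_2^')%N.
have odd_b : odd b by rewrite odd_2'nat part_pnat.
pose h := (g * d ^+ b./2)%g.
have hE : [~ J, h]%g = (d ^+ b)%g.
  have dJ i : (J * d ^+ i = d ^- i * J)%g.
    have := involution_comm_conj g linv_perm_invol.
    move/(congr1 (fun c => c ^+ i)%g); rewrite -conjXg expgVn -/d => <-.
    by rewrite conjgE linv_permV -!mulgA linv_perm_invol mulg1.
  rewrite commgEl conjgM (conjg_mulR J g) -/d conjMg.
  have -> : (d ^ (d ^+ b./2) = d)%g by apply/conjg_fixP/commgP/commuteX.
  have -> : (J ^ (d ^+ b./2) = J * (d ^+ b./2 * d ^+ b./2))%g.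
    by rewrite conjgE mulgA -dJ -mulgA.
  rewrite -!mulgA mulKg mulgA -expgD -expgSr.
  by rewrite addnn -[in RHS](odd_double_half b) odd_b.
have hM : h \in Mlt Q by rewrite groupM // groupX // comm_linv_Mlt.
have h2 : 2.-elt [~ J, h]%g by rewrite hE p_elt_exp.
have hI : h \in Inn Q by apply/InnP; split=> //; apply: comm_linv_2elt.
have : (d ^+ b == 1)%g by rewrite -hE Inn_comm_linv.
by rewrite -order_dvdn => /dvdn_odd; apply.
Qed.

(* For a prime [q] not in [pi], the [q]-part [c] of [[J, g]] fixes a point [y], so
   it commutes with [J ^ ltrans y]; as [J] inverts [c], the element [[J, ltrans y]],
   which has odd order, inverts [c] too. *)
Lemma comm_linv_pelt pi g : pi.-nat #|Q| -> g \in Mlt Q -> pi.-elt [~ J, g]%g.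
Proof.
move=> pQ gM; set d := [~ J, g]%g; apply/pnatP; first exact: order_gt0.
move=> q q_pr q_d; apply: contraLR q_d => qp.
set c := (d.`_q)%g; suff c1 : c = 1%g.
  by rewrite -p'natE //; apply/constt1P.
have c_odd : odd #[c]%g.
  apply: dvdn_odd (comm_linv_odd gM); apply/cardSg.
  by rewrite cycle_subG cycle_constt.
have cM : c \in Mlt Q.
  have := comm_linv_Mlt gM; rewrite -cycle_subG => /subsetP; apply.
  exact: cycle_constt.
have cJ : (c ^ J = c^-1)%g.
  by rewrite /c -consttJ involution_comm_conj ?linv_perm_invol // consttV.
have [||y fy] := @pgroup_fixpoint _ q <[c]>%G; first exact: p_elt_constt.
  by apply/negP=> qQ; have := pnat_dvd qQ pQ; rewrite pnatE // (negPf qp).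
have cJy : commute c (J ^ ltrans y)%g.
  have := Mlt_ltransV cM (fy c (cycle_id c)) => /Inn_linv_perm.
  move/(congr1 (fun e => e ^ ltrans y)%g).
  by rewrite (conjMg _ J) (conjMg J) conjgKV.
set d2 := [~ J, ltrans y]%g.
have cd2 : (c ^ d2 = c^-1)%g.
  rewrite /d2 commgEl conjgM linv_permV cJ conjVg; congr _^-1%g.
  by apply/conjg_fixP/commgP.
have d2_odd : odd #[d2]%g by apply: comm_linv_odd (ltrans_Mlt y).
have c_d2 : commute c d2.
  have -> : d2 = ((d2 ^+ 2) ^+ (#[d2].+1)./2)%g.
    by rewrite -expgM mul2n even_halfK ?expgSr ?expg_order ?mul1g //= negbK.
  apply/commuteX/commgP/conjg_fixP.
  by rewrite expgS expg1 conjgM cd2 conjVg cd2 invgK.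
have : (c ^+ 2 == 1)%g.
  by rewrite expgS expg1 -eq_invg_mul -cd2; apply/eqP/conjg_fixP/commgP.
rewrite -order_dvdn; case/primeP: (isT : prime 2) => _ /[apply] /orP[].
  by rewrite order_eq1 => /eqP.
by move/eqP => c2; rewrite c2 in c_odd.
Qed.

(** [[~ J, ltrans y]] is the quotient of the commuting maps [ltrans y] and [ltrans (linv y)]. If
    their [n]-th powers agree, [J] fixes the common image of [1]. *)
Lemma ltrans_expn_period y n :
  ([~ J, ltrans y] ^+ n = 1)%g -> (ltrans y ^+ n)%g 1 = 1.
Proof.
rewrite commgEr conjVg ltrans_linv expgMn; last first.
  by apply/commute_sym/commuteV/ltrans_linvC.
rewrite expgVn => /eqP; rewrite -eq_invg_mul invgK => /eqP E.
apply: linv_fix.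
by rewrite -linv_permE -permJ conjXg ltrans_linv E linv_permE linv1.
Qed.

End OddOrder.

(** * Action of translations on a free elementary abelian subgroup inverted by [J] *)

Section InvertedSubgroup.
Variables (p : nat) (V : {group {perm Q}}).
Hypotheses (p_pr : prime p) (p_odd : odd p).
Hypotheses (abelV : p.-abelem V) (nVG : (Mlt Q \subset 'N(V))%g).
Hypothesis freeV : {in V, forall (v : {perm Q}) y, v y = y -> v = 1%g}.
Hypothesis invV : {in V, forall v, v ^ J = v^-1}%g.
Implicit Types v w : {perm Q}.

Let abV v w : v \in V -> w \in V -> (v * w = w * v)%g.
Proof. by have /abelem_abelian/centsP cV := abelV; move=> vV wV; apply: cV. Qed.

Let conjV x v : v \in V -> (v ^ ltrans x)%g \in V.
Proof. by move=> vV; rewrite memJ_norm // (subsetP nVG) // ltrans_Mlt. Qed.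

Let freeV2 v w y : v \in V -> w \in V -> v y = w y -> v = w.
Proof.
move=> vV wV vw; apply/eqP; rewrite eq_mulgV1; apply/eqP.
by apply: (@freeV _ _ y); rewrite ?groupM ?groupV // permM vw permK.
Qed.

Let sqrV_inj v w : v \in V -> w \in V -> (v * v = w * w)%g -> v = w.
Proof.
have [_ expV] := abelemP p_pr abelV.
(* As [u ^+ p = 1] with [p] odd, raising to the power [(p + 1) / 2] undoes squaring. *)
have sqrtV u : u \in V -> u = ((u * u) ^+ (p.+1)./2)%g.
  move=> uV; rewrite -expg2 -expgM mul2n even_halfK /= ?p_odd //.
  by rewrite expgS expV // mulg1.
by move=> vV wV vw; rewrite (sqrtV v vV) vw -sqrtV.
Qed.

Let cross_mulV t u v w : u \in V -> w \in V ->
  (t * u = v * w)%g -> (t * w^-1 = v * u^-1)%g.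
Proof.
move=> uV wV E; rewrite (canRL (mulgK _) E) -!mulgA; congr (_ * _)%g.
by rewrite abV ?groupM ?groupV // mulgKV.
Qed.

Let mul_of_invMV t u v : u \in V -> v \in V ->
  (t * v^-1 = (u * v^-1)^-1)%g -> (u * t = v * v)%g.
Proof.
move=> uV vV; rewrite invMg invgK => /(canRL (mulgKV _))->.
by rewrite !mulgA (abV uV vV) mulgK.
Qed.

Lemma mul_permr x v y : x * v y = (v ^ ltrans x)%g (x * y).
Proof. by rewrite -!ltransE permJ. Qed.

Lemma mul_perml x v y : v y * x = (v ^ ltrans x)%g (y * x).
Proof. by rewrite mulC mul_permr mulC. Qed.

(** Conjugation by [J] turns [ltrans x] into [ltrans (linv x)] and inverts both [v] and its
    conjugate. *)
Lemma conj_ltrans_linv v x : v \in V -> (v ^ ltrans (linv x) = v ^ ltrans x)%g.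
Proof.
move=> vV; have {1}-> : v = (v^-1 ^ J)%g by rewrite invV ?groupV // invgK.
by rewrite -ltrans_linv -conjJg invV ?conjV ?groupV // -conjVg invgK.
Qed.

Lemma linv_perm_mul v x : v \in V -> J (v x) = v^-1%g (J x).
Proof. by move=> vV; rewrite -invV // permJ. Qed.

(* Computing [v y * w x] both ways shows that the quotient [b w v] of the two
   sides does not depend on [x]; conjugating by [J] gives [b w^-1 v = b w v],
   whereas [b w^-1 v] is inverse to [b w v], so [b w v] has square [1]. *)
Lemma conj_ltrans_perm v w x :
  v \in V -> w \in V -> (v ^ ltrans (w x) = v ^ ltrans x)%g.
Proof.
move=> vV wV; pose b w v x := (v ^ ltrans (w x) * (v ^ ltrans x)^-1)%g.
have bV w' v' x' : w' \in V -> v' \in V -> b w' v' x' \in V.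
  by move=> w'V v'V; rewrite groupM ?groupV ?conjV.
have b_swap w' v' x' y : v' \in V -> w' \in V -> b w' v' x' = b v' w' y.
  move=> v'V w'V.
  have E : (v' ^ ltrans (w' x') * w' ^ ltrans y =
            w' ^ ltrans (v' y) * v' ^ ltrans x')%g.
    rewrite abV ?conjV // [RHS]abV ?conjV //; apply: (freeV2 (y := x' * y)).
    - by rewrite groupM ?conjV.
    - by rewrite groupM ?conjV.
    by rewrite permM [RHS]permM -mul_perml -!mul_permr -mul_perml.
  by apply: cross_mulV E; rewrite conjV.
have b_const y z : b w^-1%g v y = b w^-1%g v z.
  by rewrite (b_swap _ _ y 1) ?groupV // -(b_swap _ _ z 1) ?groupV.
have bJ : b w^-1%g v (J x) = b w v x.
  by rewrite /b -linv_perm_mul // !linv_permE !conj_ltrans_linv.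
suff b1 : b w v x = 1%g by apply/eqP; rewrite eq_mulgV1 -/(b w v x) b1.
apply: sqrV_inj; rewrite ?bV // mulg1 -{1}bJ (b_const _ (w x)).
by rewrite /b permK mulgA mulgKV mulgV.
Qed.

(* The inner map [L_(ab)^-1 L_a L_b], where [a = w 1], moves each point [z] by a
   translation [n z] in [V]; being an automorphism it commutes with inversion,
   so [n z^-1 = (n z)^-1]. *)
Lemma conj_ltrans_dAlembert b y w : w \in V ->
  (w ^ ltrans (b * y) * w ^ ltrans (b * linv y) =
   (w ^ ltrans b) ^ ltrans y * (w ^ ltrans b) ^ ltrans y)%g.
Proof.
move=> wV; pose D z := ((w ^ ltrans b) ^ ltrans z)%g.
have DV z : D z \in V by rewrite !conjV.
pose n z := ((w ^ ltrans (b * z) * (D z)^-1) ^ (ltrans b)^-1)%g.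
have nV z : n z \in V.
  rewrite memJ_norm; first by rewrite groupM ?groupV ?conjV.
  by rewrite groupV (subsetP nVG) // ltrans_Mlt.
pose a := w 1; pose f := (ltrans b * ltrans a * (ltrans (a * b))^-1)%g.
have fE z : f z = n z z.
  apply: (mulIl (x := a * b)); rewrite /= -ltransE permM permKV permM !ltransE.
  rewrite ![a * _]mul_perml !mul1l mul_perml conj_ltrans_perm ?conjV // mul_permr.
  by rewrite conjgKV -permM mulgKV.
have fI : f \in Inn Q.
  apply/InnP; split; first by rewrite !(groupM, groupV) ?ltrans_Mlt.
  by rewrite fE /n /D mull1 ltrans1 conjg1 mulgV conj1g perm1.
have nN : n (linv y) = (n y)^-1%g.
  apply: (freeV2 (y := linv y)); rewrite ?groupV ?nV //.
  by rewrite -fE Inn_linv // fE -!linv_permE linv_perm_mul.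
move/(congr1 (fun u => u ^ ltrans b)%g): nN; rewrite -conjVg !conjgKV.
rewrite /D conj_ltrans_linv ?conjV //.
by apply: mul_of_invMV; rewrite !conjV.
Qed.

(** The left side of d'Alembert's equation is symmetric in [b] and [y], since [b * linv y] and
    [y * linv b] are mutually inverse; then cancel the squares. *)
Lemma conj_ltransC x y w : w \in V ->
  ((w ^ ltrans x) ^ ltrans y = (w ^ ltrans y) ^ ltrans x)%g.
Proof.
move=> wV; apply: sqrV_inj; rewrite ?conjV // -!conj_ltrans_dAlembert //.
congr (_ * _)%g; first by rewrite mulC.
by rewrite -(conj_ltrans_linv _ wV) linvM linvK mulC.
Qed.

(** In additive notation for [V], conjugating [u] by translations by successive powers of [y] gives
    a periodic solution of d'Alembert's equation, with [T] conjugation by [ltrans y]. *)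
Lemma ltrans_expn_cent y r u : u \in V -> (ltrans y ^+ (p ^ r))%g 1 = 1 ->
  (u ^ (ltrans y ^+ (p ^ r)) = u)%g.
Proof.
move=> uV Ly1; have [-> | ntu] := eqVneq u 1%g; first by rewrite conj1g.
have ntV : V :!=: 1%g by apply: contraNneq ntu => V1; apply/eqP/set1gP; rewrite -V1.
pose E := abelem_rV abelV ntV; pose T a := E (rVabelem abelV ntV a ^ ltrans y)%g.
pose pt n := (ltrans y ^+ n)%g 1; pose g n := E (u ^ ltrans (pt n))%g.
have EK v : v \in V -> rVabelem abelV ntV (E v) = v by exact: abelem_rV_K.
have T_add : {morph T : a b / a + b}%R.
  by move=> a b; rewrite /T rVabelemD conjMg /E abelem_rV_M ?conjV ?mem_rVabelem.
have g_step n : (g n + g n.+2 = T (g n.+1) *+ 2)%R.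
  set b := pt n.+1.
  have b1 : pt n.+2 = b * y by rewrite /pt expgSr permM ltransE mulC.
  have b2 : pt n = b * linv y by rewrite mulC linv_mul_expn.
  have DV : ((u ^ ltrans b) ^ ltrans y)%g \in V by rewrite !conjV.
  rewrite /T /g EK ?conjV // GRing.mulr2n -!abelem_rV_M ?conjV // b1 b2.
  by rewrite -conj_ltrans_dAlembert // abelem_rV_M ?conjV // GRing.addrC -abelem_rV_M
    ?conjV.
have g_per n : g (n + p ^ r)%N = g n.
  by rewrite /g /pt addnC expgD permM Ly1.
have charE (a : 'rV['F_p]_(abelem_dim' V).+1) : (a *+ p = 0)%R.
  by rewrite -GRing.scaler_nat pchar_Fp_0 // GRing.scale0r.
have := dAlembert_pow T_add g_step p_pr charE g_per.
have nL n : (ltrans y ^+ n)%g \in 'N(V)%g.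
  by rewrite groupX // (subsetP nVG) // ltrans_Mlt.
have -> n : iter n T (g 0) = E (u ^ (ltrans y ^+ n))%g.
  elim: n => [|n IHn] /=.
    by rewrite /g /pt perm1 ltrans1 conjg1.
  by rewrite IHn /T EK ?memJ_norm // -conjgM -expgSr.
rewrite /g /pt perm1 ltrans1 conjg1 !GRing.mulr2n -!abelem_rV_M ?memJ_norm //.
move/abelem_rV_inj => uu; apply: sqrV_inj; rewrite ?memJ_norm //.
by apply: uu; rewrite groupM ?memJ_norm.
Qed.

(** Modulo the centralizer [C] of [V] the translations commute and have [p]-power order, so [Mlt Q]
    is [C] times a Sylow subgroup [P]. The normal subgroup [V] of the [p]-group [V <*> P] meets its
    center. *)
Lemma ex_Mlt_central : V :!=: 1%g ->
    (forall y, exists r, (ltrans y ^+ (p ^ r))%g 1 = 1) ->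
  exists2 v, v \in V & v != 1%g /\ {in Mlt Q, forall g, commute v g}.
Proof.
move=> ntV perQ; pose C := 'C_(Mlt Q)(V)%G.
have nCG : (Mlt Q \subset 'N(C))%g by rewrite normsI ?normG // norms_cent.
have nCL y : (ltrans y \in 'N(C))%g by rewrite (subsetP nCG) // ltrans_Mlt.
have MltE' : (Mlt Q / C = <<[set ltrans x | x in Q] / C>>)%g.
  rewrite MltE quotient_gen //; apply/subsetP=> _ /imsetP[x _ ->]; exact: nCL.
have abGC : abelian (Mlt Q / C)%g.
  rewrite MltE' abelian_gen; apply/centsP.
  move=> _ /morphimP[_ _ /imsetP[x _ ->] ->] _ /morphimP[_ _ /imsetP[y _ ->] ->].
  apply/commgP; rewrite -morphR ?nCL //= coset_id // inE groupR ?ltrans_Mlt //=.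
  apply/centP=> v vV; apply/commute_sym/commgP/conjg_fixP.
  (* Passing to [w] absorbs the commutator, as [b * a * [~ a, b] = a * b]. *)
  rewrite -[v](conjgKV (ltrans y * ltrans x)%g); set w := (v ^ _)%g.
  have wV : w \in V by rewrite memJ_norm // groupV (subsetP nVG) ?groupM ?ltrans_Mlt.
  by rewrite -conjgM -commgC !conjgM conj_ltransC.
have pGC : p.-group (Mlt Q / C)%g.
  suff sub_pcore : (Mlt Q / C \subset 'O_p(Mlt Q / C))%g.
    exact: pgroupS sub_pcore (pcore_pgroup _ _).
  rewrite {1}MltE' gen_subG; apply/subsetP=> _ /morphimP[_ _ /imsetP[y _ ->] ->].
  have hallO := nilpotent_pcore_Hall p (abelian_nil abGC).
  rewrite (mem_normal_Hall hallO (pcore_normal _ _)).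
    have [r Ly1] := perQ y; apply: (@pnat_dvd _ (p ^ r)).
      rewrite order_dvdn -morphX ?nCL //= coset_id // inE groupX ?ltrans_Mlt //=.
      apply/centP=> v vV; apply/commute_sym/commgP/conjg_fixP.
      exact: ltrans_expn_cent.
    by rewrite pnatX pnat_id.
  by rewrite mem_quotient ?ltrans_Mlt.
have [P sylP] := Sylow_exists p (Mlt Q); have [sPG pP _] := and3P sylP.
have nVP : (P \subset 'N(V))%g by apply: subset_trans nVG.
have GE : (Mlt Q \subset C * P)%g.
  rewrite -quotientSK // (_ : P / C = Mlt Q / C)%g //.
  by apply: pHall_id pGC; apply: quotient_pHall => //; apply: subset_trans nCG.
have pVP : p.-group (V <*> P)%g.
  by rewrite norm_joinEr // pgroupM pP (abelem_pgroup abelV).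
have nsV : (V <| V <*> P)%g by rewrite /normal joing_subl join_subG normG.
have /trivgPn[v /setIP[vV /centerP[_ cv]] ntv] :=
  meet_center_nil (pgroup_nil pVP) nsV ntV.
exists v => //; split=> // g /(subsetP GE)/mulsgP[c x /setIP[_ cc] xP ->].
apply: commuteM; first by apply: commute_sym; move/centP: cc; apply.
by apply: cv; rewrite mem_gen // inE xP orbT.
Qed.

End InvertedSubgroup.

(** * From a transitive Sylow subgroup to a nontrivial center *)

(** The order of [X] is [#|Q|] times the [p]-part of [#|Inn Q|], and the latter bounds the
    stabilizer of [1] in [X]; so the orbit of [1] fills [Q]. *)
Lemma Mlt_Sylow_transitive (p : nat) (X : {group {perm Q}}) y :
  p.-nat #|Q| -> p.-Sylow(Mlt Q) X -> exists2 x, x \in X & x 1 = y.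
Proof.
move=> pQ sylX; have [sXG pX _] := and3P sylX.
have orbG : orbit 'P (Mlt Q) (1%loop : Q) = setT.
  apply/setP=> z; rewrite inE; apply/orbitP; exists (ltrans z).
    exact: ltrans_Mlt.
  by rewrite /= apermE ltransE mull1.
have Q_gt0 : 0 < #|Q| by apply/card_gt0P; exists 1%loop.
have cardG : (#|Inn Q| * #|Q|)%N = #|Mlt Q|.
  rewrite -(Lagrange (subsetIl (Mlt Q) _ : Inn Q \subset Mlt Q)).
  by rewrite -card_orbit orbG cardsT.
have : orbit 'P X (1%loop : Q) = setT.
  apply/eqP; rewrite eqEcard subsetT cardsT /=.
  set K := 'C_X[1%loop | 'P]%G; have sKX : K \subset X by exact: subsetIl.
  rewrite -(leq_pmul2l (cardG_gt0 K)) card_orbit Lagrange //.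
  rewrite (card_Hall sylX) -cardG partnM ?cardG_gt0 //.
  rewrite [(#|Q|`_p)%N]part_pnat_id // leq_mul2r; apply/orP; right.
  apply: dvdn_leq; first exact: part_gt0.
  rewrite -(part_pnat_id (pgroupS sKX pX)); apply: partn_dvd.
    exact: cardG_gt0.
  by apply: cardSg; apply: setSI.
move/setP/(_ y); rewrite inE => /orbitP[x xX <-].
by exists x; rewrite //= apermE.
Qed.

(** [J] commutes with [Inn Q], so in [[~ J, g]] one may replace [g] by an element of a [J]-invariant
    Sylow subgroup [X] with the same value at [1]. *)
Lemma comm_linv_pgroup (p : nat) :
  p.-nat #|Q| -> odd #|Q| -> p.-group [~: <[J]>, Mlt Q]%g.
Proof.
move=> pQ oddQ.
have [X sylX nXJ] := involution_normalizes_Sylow linv_perm_invol linv_norm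
  (fun g gM => comm_linv_pelt oddQ pQ gM).
have [sXG pX _] := and3P sylX; apply: pgroupS pX.
rewrite gen_subG; apply/subsetP=> _ /imset2P[_ g /cycleP[n ->] gM ->].
have comJ : [~ J, g]%g \in X.
  have [x xX x1] := Mlt_Sylow_transitive (g 1) pQ sylX.
  have gxI : (g * x^-1)%g \in Inn Q.
    apply/InnP; split; first by rewrite groupM ?groupV // (subsetP sXG).
    by rewrite permM -x1 permK.
  have -> : [~ J, g]%g = [~ J, x]%g.
    by rewrite !commgEl -[in LHS](mulgKV x g) conjgM Inn_linv_conj.
  by rewrite commgEr groupMr // memJ_norm // groupV.
rewrite -[n]odd_double_half expgD -mul2n expgM expg2 linv_perm_invol expg1n mulg1.
by case: (odd n); rewrite ?expg1 // expg0 comm1g.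
Qed.

Lemma ex_center (p : nat) : prime p -> odd p -> p.-nat #|Q| -> 1 < #|Q| ->
  exists2 a, a \in loop_center Q & a != 1.
Proof.
move=> p_pr p_odd pQ Q_gt1.
have oddQ : odd #|Q| by case/p_natP: pQ => k ->; rewrite oddX p_odd orbT.
pose A := [~: <[J]>, Mlt Q]%G.
have pA : p.-group A by exact: comm_linv_pgroup.
have nAG : (Mlt Q \subset 'N(A))%g by exact: commg_normr.
have nAJ : (<[J]> \subset 'N(A))%g by exact: commg_norml.
have transA y : exists2 a, a \in A & a 1 = y.
  (* [[~ J, ltrans x]] sends [1] to [x * x]. *)
  have [x <-] := ex_sqrt oddQ y; exists [~ J, ltrans x]%g.
    by rewrite mem_commg ?cycle_id ?ltrans_Mlt.
  rewrite commgEr conjVg ltrans_linv permM ltransE; congr (_ * _).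
  apply: (mulIl (x := linv x)); rewrite /= -ltransE permKV.
  by rewrite mulC mul_linv.
pose V := 'Ohm_1('Z(A))%G.
have sVZ : V \subset 'Z(A)%g by exact: Ohm_sub.
have charV : (V \char A)%g by apply: char_trans (Ohm_char _ _) (center_char _).
have nVG : (Mlt Q \subset 'N(V))%g by apply: char_norm_trans charV nAG.
have nVJ : J \in ('N(V))%g by rewrite -cycle_subG (char_norm_trans charV).
have abelV : p.-abelem V.
  by apply: Ohm1_abelem (pgroupS (center_sub _) pA) (center_abelian _).
have freeV : {in V, forall (v : {perm Q}) y, v y = y -> v = 1%g}.
  (* A permutation centralizing the transitive group [A] and fixing one point fixes all. *)
  move=> v /(subsetP sVZ)/centerP[_ cv] y vy; apply/permP=> z; rewrite perm1.
  have [a aA a1] := transA y; have [b bA b1] := transA z.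
  have := cv (a^-1 * b)%g; rewrite groupM ?groupV // => /(_ isT)/permP/(_ y).
  by rewrite !permM vy -a1 permK b1.
have ntV : V :!=: 1%g.
  rewrite Ohm1_eq1 center_nil_eq1 ?(pgroup_nil pA) //; apply/eqP=> A1.
  move: Q_gt1; rewrite ltnNge => /negP; apply; rewrite -(card1 (1%loop : Q)).
  apply: subset_leq_card; apply/subsetP=> y _; have [a] := transA y.
  by rewrite A1 => /set1gP-> <-; rewrite perm1 inE.
have cVV : {in V &, forall v w : {perm Q}, commute v w}.
  by have /abelem_abelian/centsP cV := abelV; move=> v w vV; apply: cV.
have invV : {in V, forall v : {perm Q}, v ^ J = v^-1}%g.
  (* [J] centralizes [c], hence fixes [c 1]; so [c 1 = 1] and freeness gives [c = 1]. *)
  move=> v vV; pose c := (v * v ^ J)%g.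
  have vJV : (v ^ J)%g \in V by rewrite memJ_norm.
  have cV : c \in V by rewrite groupM.
  have cJ : (c ^ J = c)%g.
    by rewrite conjMg -conjgM linv_perm_invol conjg1 cVV.
  apply/esym/eqP; rewrite eq_invg_mul; apply/eqP/(freeV c cV 1).
  by apply: (linv_fix oddQ); rewrite -linv_permE -permJ cJ linv_permE linv1.
have perQ y : exists r, (ltrans y ^+ (p ^ r))%g 1 = 1.
  have /p_natP[r r_def] := comm_linv_pelt oddQ pQ (ltrans_Mlt y).
  by exists r; apply: ltrans_expn_period => //; rewrite -r_def expg_order.
have [v vV [ntv cv]] := ex_Mlt_central p_pr p_odd abelV nVG freeV invV ntV perQ.
(* Commuting with all translations makes [v] multiplication by [v 1]; the same relations are the
   associativity laws for [v 1]. *)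
have vE x : v x = x * v 1.
  by rewrite -[RHS]ltransE -permM cv ?ltrans_Mlt // permM ltransE mull1.
have vM x y : x * v y = v (x * y).
  by rewrite -!ltransE -!permM cv ?ltrans_Mlt.
exists (v 1); last by apply: contraNneq ntv => v1; apply/eqP/(freeV v vV 1).
apply/loop_centerP; split=> [x|x y|x y|x y].
- exact: mulC.
- by rewrite ![v 1 * _]mulC -!vE mulC vM mulC.
- by rewrite [v 1 * y]mulC -!vE vM mulC vM mulC.
- by rewrite -!vE vM.
Qed.

End CommutativeAutomorphic.

(** * Inheritance by quotient loops *)

Section QuotientLoop.
Variables (Q : finLoopType) (N : normalSubloop Q).
Local Notation QN := (loop_quotient N).
Local Notation pr := (loop_proj N).

Lemma quo_commutative : loop_commutative Q -> loop_commutative QN.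
Proof.
by move=> mulC A B; rewrite -(quo_reprK A) -(quo_reprK B) -!loop_projM mulC.
Qed.

(** Converse to [Mlt_proj]: the permutations that lift form a group containing all translations. *)
Lemma Mlt_lift (g : {perm QN}) : g \in Mlt QN ->
  exists2 f : {perm Q}, f \in Mlt Q & forall x, pr (f x) = g (pr x).
Proof.
pose P (h : {perm QN}) := [exists f : {perm Q},
  (f \in Mlt Q) && [forall x, pr (f x) == h (pr x)]].
have liftP (h : {perm QN}) : reflect (exists2 f : {perm Q}, f \in Mlt Q &
    forall x, pr (f x) = h (pr x)) (P h).
  apply: (iffP existsP) => [[f /andP[fM /forallP fE]] | [f fM fE]].
    by exists f => // x; apply/eqP.
  by exists f; rewrite fM; apply/forallP=> x; apply/eqP.
have gP : group_set [set h | P h].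
  apply/group_setP; split=> [|h k]; rewrite !inE.
    by apply/liftP; exists 1; rewrite ?group1 // => x; rewrite !perm1.
  move=> /liftP[f fM fE] /liftP[f' fM' fE']; apply/liftP.
  by exists (f * f'); rewrite ?groupM // => x; rewrite !permM fE' fE.
move=> gM; apply/liftP; suff: Mlt QN \subset Group gP.
  by move/subsetP/(_ _ gM); rewrite inE.
rewrite gen_subG subUset; apply/andP.
split; apply/subsetP=> _ /imsetP[A _ ->]; rewrite inE; apply/liftP.
  exists (ltrans (quo_repr A)) => [|y]; first exact: ltrans_Mlt.
  by rewrite !ltransE loop_projM quo_reprK.
exists (rtrans (quo_repr A)) => [|y]; first exact: rtrans_Mlt.
by rewrite !rtransE loop_projM quo_reprK.
Qed.

Lemma quo_automorphic : automorphic Q -> automorphic QN.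
Proof.
move=> autoQ g /InnP[gM g1] A B; have [f fM fE] := Mlt_lift gM.
(* The lift [f] may move [1] within [N]; dividing by [ltrans (f 1)] makes it inner without changing
   the induced map. *)
pose h := f * (ltrans (f 1%loop))^-1.
have prf1 : pr (f 1%loop) = 1%loop by rewrite fE loop_proj1 g1.
have hE x : pr (h x) = g (pr x).
  have fx : f x = (f 1 * h x)%loop by rewrite -ltransE permM permKV.
  by rewrite -fE fx loop_projM prf1 mul1l.
have hI : h \in Inn Q.
  apply/InnP; split; first by rewrite groupM ?groupV ?ltrans_Mlt.
  by apply: (mulIl (x := f 1%loop)); rewrite /= -ltransE permM permKV mull1.
rewrite -(quo_reprK A) -(quo_reprK B) -loop_projM -!hE (autoQ h hI).
by rewrite loop_projM.
Qed.

Lemma card_loop_quotient : (#|{: QN}| * #|(N : {set Q})|)%N = #|Q|.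
Proof.
rewrite -[RHS]sum1_card (partition_big pr xpredT) //= -sum_nat_const.
apply: eq_bigr => A _; rewrite -(quo_reprK A) sum1dep_card.
rewrite -[LHS](card_imset _ (mulIl (x := quo_repr A))); apply: eq_card => x.
by rewrite inE; apply/idP/eqP => [/loop_proj_eq | /loop_proj_eq].
Qed.

Lemma quo_pnat (p : nat) : p.-nat #|Q| -> p.-nat #|{: QN}|.
Proof. by apply: pnat_dvd; rewrite -card_loop_quotient dvdn_mulr. Qed.

End QuotientLoop.

(** * Growth of the upper central series *)

Lemma upper_centralS (Q : finLoopType) i :
  (upper_central Q i : {set Q}) \subset upper_central Q i.+1.
Proof.
apply/subsetP=> x xZ; rewrite inE /=.
have -> : loop_proj (upper_central Q i) x = 1%loop.
  rewrite -loop_proj1; apply/loop_proj_eq/imsetP; exists x => //.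
  by rewrite mul1l.
exact: (nsl1 (center_nsl _)).
Qed.

Theorem theorem1p1 (p : nat) (Q : finLoopType) :
  prime p -> odd p ->
  loop_commutative Q -> automorphic Q -> p_loop p Q ->
  centrally_nilpotent Q.
Proof.
move=> p_pr p_odd mulC autoQ [k cardQ].
have pQ : p.-nat #|Q| by rewrite cardQ pnatX pnat_id.
pose Z i : {set Q} := upper_central Q i.
(* A nontrivial quotient by [Z i] has a nontrivial central element, whose representative lies in
   [Z i.+1] but not in [Z i]. *)
have Z_mono i : Z i.+1 = setT \/ Z i \proper Z i.+1.
  have [ZT | ntZ] := eqVneq (Z i) setT.
    by left; apply/eqP; rewrite -subTset -ZT upper_centralS.
  right; rewrite properE upper_centralS /=.
  set N := upper_central Q i; have N_gt1 : 1 < #|{: loop_quotient N}|.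
    move: ntZ; rewrite eqEcard subsetT cardsT -ltnNge -(card_loop_quotient N).
    by rewrite -{1}[#|_|]mul1n ltn_mul2r => /andP[].
  have [A AZ ntA] := ex_center (quo_commutative mulC) (quo_automorphic autoQ)
    p_pr p_odd (quo_pnat N pQ) N_gt1.
  apply/subsetPn; exists (quo_repr A); first by rewrite inE /= quo_reprK.
  apply: contra ntA => AN; rewrite -(quo_reprK A) -loop_proj1.
  apply/eqP/loop_proj_eq/imsetP; exists (quo_repr A) => //.
  by rewrite mul1l.
(* Each proper step adds a point, so the second alternative fails at [i = #|Q|]. *)
have large i : Z i = setT \/ i < #|Z i|.
  elim: i => [|i [ZT | ltiZ]]; first by right; rewrite cards1.
    by left; case: (Z_mono i) => //; rewrite ZT => /andP[_ /negP[]]; exact: subsetT.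
  by case: (Z_mono i) => [|/proper_card ltZ]; [left | right; apply: leq_trans ltZ].
by exists #|Q|; case: (large #|Q|) => //; rewrite ltnNge max_card.
Qed.
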